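(* Let $(G_i)_{i\ge1}$ be a sequence of distance-regular graphs, $G_i$ having $n_i$ vertices, degree $k_i$, parameters $\lambda_i,\mu_i$ and least adjacency eigenvalue $s_i$, with $n_i\to\infty$ and $|s_i|\mu_i/\lambda_i \to 0$ (i.e. $|s|\mu = o(\lambda)$). Then $G_i$ is asymptotically Delsarte-geometric: there is a sequence $\varepsilon_i\to 0$ such that for all sufficiently large $i$, $G_i$ has a clique geometry all of whose special cliques have order between $(1-\varepsilon_i)k_i/|s_i|$ and $(1+\varepsilon_i)k_i/|s_i|$ (i.e. order $\sim k_i/|s_i|$).
   Context: A connected graph is distance-regular if for any two vertices $u,v$ at distance $i$, the numbers of neighbors of $v$ at distance $i-1$, $i$, and $i+1$ from $u$ depend only on $i$. For a distance-regular graph, $k$ is its degree, $\lambda$ is the number of common neighbors of two adjacent vertices, $\mu$ is the number of common neighbors of two vertices at distance two, and $s$ is the least eigenvalue of its adjacency matrix (so $s<0$). The order of a clique is its number of vertices. A collection $\mathcal{C}$ of cliques of a graph is a clique geometry if (i) every clique in $\mathcal{C}$ is a maximal clique and (ii) every pair of adjacent vertices belongs to exactly one member of $\mathcal{C}$; the members of $\mathcal{C}$ are called special cliques. *)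

(* Defs.v *)
From HB Require Import structures.
From mathcomp Require Import all_boot all_order all_algebra.
From mathcomp Require Import reals.
Set Implicit Arguments. Unset Strict Implicit. Unset Printing Implicit Defensive.
Import Order.TTheory GRing.Theory Num.Theory.
Local Open Scope ring_scope.

Section Graphs.
Variables (T : finType) (e : rel T).

Definition simple_graph := symmetric e /\ irreflexive e.

Fixpoint within (n : nat) (u v : T) : bool :=
  if n is n'.+1 then within n' u v || [exists w, within n' u w && e w v]
  else u == v.

(* graph distance (for connected graphs this is < #|T|) *)
Definition dist (u v : T) : nat := find (fun n => within n u v) (iota 0 #|T|).

Definition connected_graph := forall u v : T, connect e u v.

Definition nbr_at (u v : T) (j : nat) : nat := #|[set w | e v w & dist u w == j]|%N.

Definition distance_regular : Prop :=
  simple_graph /\ connected_graph /\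
  forall (i : nat) (u v u' v' : T), dist u v = i -> dist u' v' = i ->
    [/\ nbr_at u v i.-1 = nbr_at u' v' i.-1,
        nbr_at u v i = nbr_at u' v' i &
        nbr_at u v i.+1 = nbr_at u' v' i.+1].

Definition degree_is (k : nat) := forall v : T, #|[set w | e v w]| = k.
Definition lambda_is (l : nat) :=
  forall u v : T, e u v -> #|[set w | e u w & e v w]| = l.
Definition mu_is (m : nat) :=
  forall u v : T, dist u v = 2 -> #|[set w | e u w & e v w]| = m.

Definition adjmx (R : nzRingType) : 'M[R]_#|T| :=
  \matrix_(i, j) (e (enum_val i) (enum_val j))%:R.

Definition least_eigenvalue (R : realType) (s : R) :=
  eigenvalue (adjmx R) s /\ forall a : R, eigenvalue (adjmx R) a -> s <= a.

Definition is_clique (K : {set T}) := forall x y, x \in K -> y \in K -> x != y -> e x y.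
Definition maximal_clique (K : {set T}) :=
  is_clique K /\ forall K' : {set T}, is_clique K' -> K \subset K' -> K' = K.

Definition clique_geometry (C : {set {set T}}) :=
  (forall K, K \in C -> maximal_clique K) /\
  (forall x y, e x y -> exists! K, K \in C /\ x \in K /\ y \in K).

End Graphs.

(* Main.v *)
(* Write sigma = - s.  Testing A - s I >= 0 on vectors supported on a vertex and
   its neighbourhood gives k <= sigma (lambda + sigma), and Delsarte's bound gives
   |K| <= 1 + k / sigma for every clique K.  Since sigma mu = o(lambda), the first
   inequality bounds the stable sets in a neighbourhood N(v) by t = O(sigma).  For a
   maximum stable set S of N(v), the vertices of N(v) whose only neighbour in S
   (up to equality) is w form a clique of order at least lambda - t mu, and these
   cliques absorb all of N(v), since a vertex missing from all of them would give a
   larger stable set.  Hence the maximal cliques of order at least lambda - t mu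
   form a clique geometry, and lambda - t mu ~ lambda >~ k / sigma matches
   Delsarte's bound.  If no two nonadjacent vertices have a common neighbour, the
   graph is complete and mu is unconstrained; this case is treated apart. *)
Require Import Defs.
From HB Require Import structures.
From mathcomp Require Import all_boot all_order all_algebra.
From mathcomp Require Import reals.
From mathcomp Require Import complex.
From mathcomp Require Import zify ring lra.
Set Implicit Arguments. Unset Strict Implicit. Unset Printing Implicit Defensive.
Import Order.TTheory GRing.Theory Num.Theory.
Local Open Scope ring_scope.

(** * The Rayleigh bound for real symmetric matrices *)

Lemma spectral_diag_eigenvalue (C : numClosedFieldType) n (A : 'M[C]_n) j :
  A \is normalmx -> eigenvalue A (spectral_diag A 0 j).
Proof.
move=> /orthomx_spectralP; set P := spectralmx A; set d := spectral_diag A => eA.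
have uP : P \in unitmx by exact: spectral_unit.
apply/eigenvalueP; exists (row j P).
  rewrite -row_mul {1}eA !mulmxA mulmxV // mul1mx row_mul row_diag_mx.
  by rewrite -scalemxAl -rowE.
apply/eqP => r0; have := congr1 (mulmx^~ (invmx P)) r0.
rewrite mul0mx -row_mul mulmxV // row1 => /rowP/(_ j)/eqP.
by rewrite !mxE !eqxx oner_eq0.
Qed.

(** Over [R[i]] the matrix is Hermitian, hence unitarily diagonalisable with real eigenvalues. These
    are roots of the characteristic polynomial of [A], so [s] bounds them from below. In the
    coordinates [z] the form is the sum of the [d 0 j * |z_j|^2]. *)
Lemma rayleigh_ge (R : rcfType) n (A : 'M[R]_n) (s : R) (x : 'rV[R]_n) :
  A^T = A -> (forall a, eigenvalue A a -> s <= a) ->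
  s * (x *m x^T) 0 0 <= (x *m A *m x^T) 0 0.
Proof.
move=> symA s_min.
pose toC := real_complex R; pose B := map_mx toC A; pose y := map_mx toC x.
have realM m1 n1 (M : 'M[R]_(m1, n1)) : map_mx toC M \is a realmx.
  by apply/mxOverP => i j; rewrite mxE; apply/complex_realP; eexists.
have hermB : B \is hermsymmx.
  apply: realsym_hermsym (realM _ _ _); apply/is_hermitianmxP.
  by rewrite expr0 scale1r map_mx_id // /B map_trmx symA.
have normB := hermitian_normalmx hermB.
have realD := hermitian_spectral_diag_real hermB.
have /orthomx_spectralP eB := normB.
set P := spectralmx B in eB; set d := spectral_diag B in eB realD.
have unitP : P \is unitarymx by exact: spectral_unitarymx.
have invP := invmx_unitary unitP.
pose z := y *m invmx P.
have zT : P *m y^T = map_mx Num.conj z^T.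
  rewrite /z invP trmx_mul map_mxM !map_trmx trmxK -map_mx_comp (map_mx_id (@conjCK _)).
  by congr (_ *m _); apply: esym; exact: (realmxC (realM _ _ _)).
have s_le j : toC s <= d 0 j.
  have /complex_realP [a da] : d 0 j \is Num.real by apply: (mxOverP realD).
  have := spectral_diag_eigenvalue j normB; rewrite -/d da eigenvalue_root_char.
  rewrite /B -map_char_poly fmorph_root -eigenvalue_root_char => /s_min.
  by rewrite lecR.
have toCE (M : 'M[R]_1) : toC (M 0 0) = (map_mx toC M) 0 0 by rewrite mxE.
rewrite -lecR rmorphM /= -!/(toC _) !toCE !map_mxM /= -/B -map_trmx -/y.
have -> : y *m y^T = z *m map_mx Num.conj z^T.
  by rewrite -zT /z mulmxA mulmxKV // unitarymx_unit.
rewrite eB !mulmxA -/z -[_ *m P *m _]mulmxA zT !mxE mulr_sumr; apply: ler_sum => j _.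
rewrite mul_mx_diag !mxE mulrAC [X in _ <= X]mulrC.
by apply: ler_wpM2r => //; rewrite mul_conjC_ge0.
Qed.

(** * Cliques and stable sets in neighbourhoods *)

Section Combinatorics.
Local Open Scope nat_scope.
Variables (T : finType) (e : rel T).
Hypotheses (sym_e : symmetric e) (irr_e : irreflexive e).

Local Notation N v := [set w | e v w].

Definition clique_pred (K : {set T}) :=
  [forall x in K, forall y in K, (x != y) ==> e x y].

Definition stable_pred (S : {set T}) :=
  [forall x in S, forall y in S, ~~ e x y].

Lemma clique_predP (K : {set T}) : reflect (is_clique e K) (clique_pred K).
Proof.
apply: (iffP 'forall_in_'forall_in_implyP) => [h x y xK yK|h x xK y yK]; exact: h.
Qed.

Lemma stable_predP (S : {set T}) :
  reflect (forall x y, x \in S -> y \in S -> ~~ e x y) (stable_pred S).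
Proof.
by apply: (iffP 'forall_in_forall_inP) => [h x y xS yS|h x xS y yS]; apply: h.
Qed.

Lemma maximal_cliqueP K : reflect (maximal_clique e K) (maxset clique_pred K).
Proof.
apply: (iffP maxsetP) => -[/clique_predP cK mK]; split => // K' /clique_predP; exact: mK.
Qed.

Lemma card_bigcup_le (I : finType) (P : {set I}) (F : I -> {set T}) m :
  (forall i, i \in P -> #|F i| <= m) -> #|\bigcup_(i in P) F i| <= #|P| * m.
Proof.
move=> h; apply: leq_trans (_ : \sum_(i in P) #|F i| <= _).
  elim/big_rec2: _ => [|i A m' _ IH]; first by rewrite cards0.
  by apply: leq_trans (leq_card_setU _ _) _; rewrite leq_add2l.
by rewrite -sum_nat_const; apply: leq_sum.
Qed.

Variables (lam mu : nat).
Hypotheses (hlam : lambda_is e lam)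
  (hmu : forall x y, x != y -> ~~ e x y -> #|[set w | e x w & e y w]| <= mu).

(** Some [x] in [K] and [y] in [K'] are distinct and nonadjacent, since otherwise [K :|: K'] would
    be a clique and both would equal it. Every vertex of the intersection is a common neighbour of
    [x] and [y]. *)
Lemma maximal_clique_capI K K' : maximal_clique e K -> maximal_clique e K' ->
  K != K' -> #|K :&: K'| <= mu.
Proof.
move=> [cK mK] [cK' mK'] neq.
have [y yK' /existsP[x /and3P[xK xy nexy]]] :
    exists2 y, y \in K' & [exists x, [&& x \in K, x != y & ~~ e x y]].
  apply/exists_inP; apply: contraT; rewrite negb_exists_in => /forall_inP h.
  have cU : is_clique e (K :|: K').
    move=> a b; rewrite !inE => /orP[aK|aK'] /orP[bK|bK'] ab; first exact: cK.
    - by have := h _ bK'; rewrite negb_exists => /forallP/(_ a); rewrite aK ab /= negbK.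
    - have := h _ aK'; rewrite negb_exists => /forallP/(_ b).
      by rewrite bK eq_sym ab /= negbK sym_e.
    - exact: cK'.
  by rewrite -(mK _ cU (subsetUl _ _)) {1}(mK' _ cU (subsetUr _ _)) eqxx in neq.
apply: leq_trans (hmu xy nexy); apply: subset_leq_card; apply/subsetP => z.
rewrite !inE => /andP[zK zK'].
have xz : x != z by apply: contraNneq nexy => xz; apply: cK'; rewrite ?xz // -xz.
have yz : y != z by apply: contraNneq nexy => yz; apply: cK; rewrite ?yz // -yz.
by rewrite cK // cK'.
Qed.

Section Local.
Variables (v : T) (S : {set T}).
Hypotheses (SN : S \subset N v) (stS : stable_pred S).

Definition private w :=
  [set x in N v | ((x == w) || e w x) && [forall w' in S, e w' x ==> (w' == w)]].

Lemma private_sub w : private w \subset N v.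
Proof. by apply/subsetP => x; rewrite !inE => /andP[]. Qed.

Lemma private_self w : w \in S -> w \in private w.
Proof.
move=> wS; have := subsetP SN _ wS; rewrite !inE eqxx => -> /=.
by apply/forall_inP => w' w'S; rewrite (negPf (stable_predP _ stS _ _ w'S wS)).
Qed.

Lemma private_nadj w w' x : w' \in S -> w' != w -> x \in private w -> ~~ e w' x.
Proof.
move=> w'S neq; rewrite !inE => /and3P[_ _ /forall_inP/(_ _ w'S)].
by rewrite (negPf neq) implybF.
Qed.

Lemma private_neq w w' x : w \in S -> w' \in S -> w' != w -> x \in private w -> w' != x.
Proof.
move=> wS w'S neq xP; apply: contraNneq neq => w'x; move: xP; rewrite -w'x !inE.
by rewrite (negPf (stable_predP _ stS _ _ wS w'S)) orbF => /and3P[].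
Qed.

Lemma private_disjoint w w' x :
  w \in S -> w' \in S -> x \in private w -> x \in private w' -> w = w'.
Proof.
move=> wS w'S xP xP'; apply/eqP; apply: contraT => neq.
have := private_nadj wS neq xP'; have := private_neq w'S wS neq xP'.
by move: xP; rewrite !inE eq_sym => /and3P[_ /orP[->|->]].
Qed.

(** A common neighbour of [v] and [w] outside [private w] is adjacent to another [w'] in [S]. Since
    [w] and [w'] are nonadjacent, each [w'] accounts for at most [mu] such vertices. *)
Lemma card_private w : w \in S -> lam <= #|private w| + #|S| * mu.
Proof.
move=> wS; have evw : e v w by have := subsetP SN _ wS; rewrite inE.
rewrite -(hlam evw).
apply: leq_trans (_ : #|private w :|: \bigcup_(w' in S :\ w) [set z | e w z & e w' z]| <= _).
  apply: subset_leq_card; apply/subsetP => x; rewrite !inE => /andP[vx wx].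
  rewrite vx wx orbT /= -implyNb negb_forall_in; apply/implyP.
  case/exists_inP => w' w'S; rewrite negb_imply => /andP[w'x neq].
  by apply/bigcupP; exists w'; rewrite !inE ?neq ?wx.
apply: leq_trans (leq_card_setU _ _) _; rewrite leq_add2l.
apply: leq_trans (card_bigcup_le (m := mu) _) _.
  move=> w'; rewrite !inE => /andP[neq w'S]; apply: hmu; first by rewrite eq_sym.
  exact: (stable_predP _ stS).
by rewrite leq_mul2r subset_leq_card ?orbT ?subsetDl.
Qed.

(** The private sets are pairwise disjoint inside [N v]; sum [card_private] over [S]. *)
Lemma stable_degree_ge k : #|N v| = k -> #|S| * lam <= k + #|S| * #|S| * mu.
Proof.
move=> <-.
have -> : #|S| * lam = \sum_(w in S) lam by rewrite sum_nat_const.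
apply: leq_trans (_ : \sum_(w in S) (#|private w| + #|S| * mu) <= _).
  by apply: leq_sum => w; exact: card_private.
rewrite big_split /= sum_nat_const mulnA leq_add2r.
have -> : \sum_(w in S) #|private w| = \sum_(w in S) \sum_(x in N v) (x \in private w).
  apply: eq_bigr => w _; rewrite -sum1_card [RHS]big_mkcond [LHS]big_mkcond /=.
  apply: eq_bigr => x _; case: ifP => [xP|_]; last by case: ifP.
  by rewrite (subsetP (private_sub w) _ xP).
rewrite exchange_big -sum1_card /=; apply: leq_sum => x _.
have -> : \sum_(w in S) (x \in private w) = #|[set w in S | x \in private w]|.
  rewrite -sum1_card big_mkcond [RHS]big_mkcond /=; apply: eq_bigr => w _.
  by rewrite inE; case: (w \in S) => //=; case: (x \in private w).
apply/card_le1_eqP => w w' /setIdP[wS xP] /setIdP[w'S xP'].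
exact: private_disjoint w'S wS xP' xP.
Qed.

Hypothesis maxS : forall J : {set T}, J \subset N v -> stable_pred J -> #|J| <= #|S|.

(** Two nonadjacent vertices of [private w] could replace [w] in [S], giving a larger stable set. *)
Lemma private_clique w : w \in S -> is_clique e (private w).
Proof.
move=> wS x y xP yP xy; apply: contraT => nexy.
pose J := x |: (y |: S :\ w).
have nin z : z \in private w -> z \notin S :\ w.
  move=> zP; rewrite !inE negb_and negbK; case: (eqVneq z w) => //= zw.
  by apply: contraTN zP => zS; apply/negP => /(private_neq wS zS zw); rewrite eqxx.
have nadj z a : z \in private w -> a \in S :\ w -> ~~ e a z.
  by move=> zP; rewrite !inE => /andP[aw aS]; apply: private_nadj zP.
have stJ : stable_pred J.
  apply/stable_predP => a b; rewrite !(in_setU1 a) !(in_setU1 b).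
  case/or3P=> [/eqP->|/eqP->|aS] /or3P[/eqP->|/eqP->|bS]; rewrite ?irr_e //.
  - by rewrite sym_e nadj.
  - by rewrite sym_e.
  - by rewrite sym_e nadj.
  - by rewrite nadj.
  - by rewrite nadj.
  - by apply: (stable_predP _ stS); [move: aS|move: bS]; rewrite !inE => /andP[].
have JN : J \subset N v.
  rewrite !subUset !sub1set (subsetP (private_sub w)) // (subsetP (private_sub w)) //=.
  exact: subset_trans (subsetDl _ _) SN.
have := maxS JN stJ; rewrite !cardsU1 !in_setU1 (negPf xy) /= !nin //=.
by rewrite (cardsD1 w S) wS; lia.
Qed.

(* Otherwise [u] could be completed by one vertex of each [private w], chosen
   greedily, to a stable set larger than [S]. *)
Lemma private_absorbs u : e v u -> (#|S| + #|S|.+1) * mu < lam ->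
  exists2 w, w \in S & forall x, x \in private w -> x != u -> e u x.
Proof.
move=> evu small.
suff /exists_inP[w wS /forall_inP h] :
    [exists w in S, forall x in private w, (x != u) ==> e u x].
  by exists w => // x xP; exact/implyP/h.
apply: contraT; rewrite negb_exists_in => /forall_inP noabs.
have witness w : w \in S -> exists x, [/\ x \in private w, x != u & ~~ e u x].
  move=> /noabs; rewrite negb_forall_in => /exists_inP[x xP].
  by rewrite negb_imply => /andP[]; exists x.
have u_notin w : w \in S -> u \notin private w.
  move=> wS; have [x [xP xu]] := witness w wS; apply: contra => uP.
  by apply: private_clique uP xP _ => //; rewrite eq_sym.
(* Such a [z] misses some [x] in the clique [private w], so its neighbours in [private w] are common
   neighbours of [z] and [x]. *)
have card_adj w z : w \in S -> z = u \/ (exists2 w', w' \in S :\ w & z \in private w') ->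
    #|private w :&: N z| <= mu.
  move=> wS hz.
  have [x [xP zx nzx]] : exists x, [/\ x \in private w, z != x & ~~ e z x].
    case: hz => [->|[w' /setD1P[neq w'S] zP]].
      by have [x [xP xu nux]] := witness w wS; exists x; rewrite eq_sym.
    exists w; rewrite private_self // eq_sym sym_e; split=> //.
      by apply: private_neq zP; rewrite // eq_sym.
    by apply: private_nadj zP; rewrite // eq_sym.
  apply: leq_trans (hmu zx nzx); apply: subset_leq_card; apply/subsetP => a.
  move=> /setIP[aP]; rewrite !inE => za; rewrite za /=.
  by apply: (private_clique wS) => //; apply: contraNneq nzx => ->.
have greedy (W : seq T) : uniq W -> {subset W <= S} -> exists J : {set T},
    [/\ J \subset N v, stable_pred J, #|J| = (size W).+1 &
        forall z, z \in J -> z = u \/ exists2 w, w \in W & z \in private w].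
  elim: W => [_ _|w W IH /= /andP[wW uW] sW].
    exists [set u]; rewrite cards1 sub1set inE; split=> // [|z /set1P]; last by left.
    by apply/stable_predP => a b /set1P-> /set1P->; rewrite irr_e.
  have wS : w \in S by apply: sW; rewrite mem_head.
  have sW' : {subset W <= S} by move=> a aW; apply: sW; rewrite in_cons aW orbT.
  have [J [JN stJ cJ hJ]] := IH uW sW'.
  have hJw z : z \in J -> z = u \/ exists2 w', w' \in S :\ w & z \in private w'.
    move=> /hJ[->|[w' w'W zP]]; [by left|right; exists w' => //].
    by rewrite !inE sW' // andbT; apply: contraNneq wW => <-.
  have szW : size W < #|S|.
    have := uniq_leq_size (s1 := w :: W) (s2 := enum S); rewrite -cardE; apply=> /=.
      by rewrite wW.
    by move=> a /sW; rewrite mem_enum.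
  (* At least [lam - #|S| * mu] vertices are available in [private w], and each vertex of [J]
     excludes at most [mu] of them. *)
  have [y yP ynadj] : exists2 y, y \in private w & y \notin \bigcup_(z in J) (private w :&: N z).
    apply/subsetPn; apply: contraTN small => /subset_leq_card le1.
    have le2 := card_bigcup_le (fun z zJ => card_adj w z wS (hJw z zJ)).
    have le3 := card_private wS; rewrite -leqNgt.
    have : (size W).+1 * mu <= #|S|.+1 * mu by rewrite leq_mul2r; lia.
    rewrite cJ in le2; rewrite mulnDl; lia.
  have yJ z : z \in J -> ~~ e z y.
    move=> zJ; apply: contra ynadj => zy; apply/bigcupP; exists z => //.
    by rewrite inE yP inE.
  exists (y |: J); split.
  - by rewrite subUset sub1set (subsetP (private_sub w)).
  - apply/stable_predP => a b /setU1P[->|aJ] /setU1P[->|bJ]; rewrite ?irr_e ?yJ //.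
      by rewrite sym_e yJ.
    exact: (stable_predP _ stJ).
  - rewrite cardsU1 cJ; suff -> : y \notin J by [].
    apply/negP => /hJw[yu|[w' /setD1P[neq w'S] yP']].
      by have := u_notin _ wS; rewrite -yu yP.
    by rewrite (private_disjoint w'S wS yP' yP) eqxx in neq.
  - move=> z /setU1P[->|/hJ[->|[w' w'W zP]]]; [right; exists w|left|right; exists w'] => //.
      by rewrite mem_head.
    by rewrite in_cons w'W orbT.
have [J [JN stJ cJ _]] : exists J : {set T}, [/\ J \subset N v, stable_pred J,
    #|J| = (size (enum S)).+1 &
    forall z, z \in J -> z = u \/ exists2 w, w \in enum S & z \in private w].
  by apply: greedy; [exact: enum_uniq|move=> a; rewrite mem_enum].
by have := maxS JN stJ; rewrite cJ -cardE ltnn.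
Qed.
End Local.

(** * The geometry of large maximal cliques *)

Variables (t : nat).
Hypotheses (ht : forall v (S : {set T}), S \subset N v -> stable_pred S -> #|S| <= t)
  (small : (2 * t + 1) * mu + 2 < lam).

(** The order condition means [#|K| >= lam - t * mu]; the additive form avoids truncated
    subtraction. *)
Definition lines : {set {set T}} :=
  [set K | maxset clique_pred K && (lam <= #|K| + t * mu)].

(** For a maximum stable set of [N x], some [private w] absorbs [y]. Adding [x] and [y] to it gives
    a clique, and any maximal clique above that one is large enough. *)
Lemma edge_in_line x y : e x y -> exists2 K, K \in lines & (x \in K) && (y \in K).
Proof.
move=> exy.
have st0 : (set0 \subset N x) && stable_pred set0.
  by rewrite sub0set /=; apply/stable_predP => a b; rewrite inE.
have [S /andP[SN stS] maxS] :=
  @arg_maxnP _ set0 (fun S : {set T} => (S \subset N x) && stable_pred S)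
    (fun S : {set T} => #|S|) st0.
have {}maxS (J : {set T}) : J \subset N x -> stable_pred J -> #|J| <= #|S|.
  by move=> JN stJ; apply: maxS; rewrite JN.
have St := ht SN stS.
have [|w wS hw] := private_absorbs SN stS maxS exy.
  have : (#|S| + #|S|.+1) * mu <= (2 * t + 1) * mu by rewrite leq_mul2r; lia.
  lia.
have Px a : a \in private x S w -> e x a by move/(subsetP (private_sub _ _ _)); rewrite inE.
have cK : clique_pred (x |: (y |: private x S w)).
  apply/clique_predP => a b /setU1P[->|/setU1P[->|aP]] /setU1P[->|/setU1P[->|bP]];
    rewrite ?eqxx // => ab //.
  - exact: Px.
  - by rewrite sym_e.
  - by apply: hw; rewrite // eq_sym.
  - by rewrite sym_e Px.
  - by rewrite sym_e hw.
  - exact: (private_clique SN stS maxS wS).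
have [K mK sK] := maxset_exists cK.
exists K; last by rewrite !(subsetP sK) // !inE eqxx ?orbT.
rewrite inE mK /=; have := card_private SN stS wS.
have : #|private x S w| <= #|K|.
  by apply: subset_leq_card; apply: subset_trans sK; apply/subsetP => a aP;
    rewrite !in_setU1 aP !orbT.
have : #|S| * mu <= t * mu by rewrite leq_mul2r St orbT.
lia.
Qed.

(** For uniqueness, two lines through an edge meet in at most [mu] vertices, so their union has at
    least [2 * (lam - t * mu) - mu] of them. But the union lies in the edge together with its [lam]
    common neighbours, against [small]. *)
Lemma lines_clique_geometry : clique_geometry e lines.
Proof.
split=> [K|x y exy]; first by rewrite inE => /andP[/maximal_cliqueP].
have [K KL /andP[xK yK]] := edge_in_line exy.
exists K; split=> // K' [K'L [xK' yK']]; apply/eqP; apply: contraT => neq.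
move: KL K'L; rewrite !inE => /andP[/maximal_cliqueP mK cK] /andP[/maximal_cliqueP mK' cK'].
have capm := maximal_clique_capI mK mK' neq.
have : #|K :|: K'| <= #|[set x; y] :|: [set w | e x w & e y w]|.
  apply: subset_leq_card; apply/subsetP => z; rewrite !inE => zKK'.
  case: (eqVneq z x) => //= zx; case: (eqVneq z y) => //= zy.
  have [] := mK; have [] := mK' => clK' _ clK _.
  by case/orP: zKK' => zK; apply/andP; split;
    solve [apply: clK => //; rewrite eq_sym // | apply: clK' => //; rewrite eq_sym //].
move/leq_trans/(_ (leq_card_setU _ _)); rewrite (hlam exy) cardsU => le1.
have := leq_trans le1 (leq_add (_ : #|[set x; y]| <= 2) (leqnn lam)).
by rewrite cards2 => /(_ (leq_b1 _)) ; nia.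
Qed.
End Combinatorics.

(** * Graph distance and intersection numbers *)

Section Distance.
Variables (T : finType) (e : rel T).

Lemma dist_le_card x y : (dist e x y <= #|T|)%N.
Proof. by rewrite /dist (leq_trans (find_size _ _)) // size_iota. Qed.

Lemma within_dist x y : (dist e x y < #|T|)%N -> within e (dist e x y) x y.
Proof.
move=> lt; have h : has (within e ^~ x ^~ y) (iota 0 #|T|) by rewrite has_find size_iota.
by have := nth_find 0%N h; rewrite nth_iota.
Qed.

Lemma dist_le n x y : within e n x y -> (dist e x y <= n)%N.
Proof.
move=> w; rewrite leqNgt; apply/negP => lt.
have := before_find 0%N lt.
by rewrite nth_iota ?w // (leq_trans lt) ?dist_le_card.
Qed.

Lemma dist_step x y z : e y z -> (dist e x z <= (dist e x y).+1)%N.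
Proof.
move=> yz; case: (ltnP (dist e x y) #|T|) => [lt|ge].
  apply: dist_le => /=; apply/orP; right; apply/existsP; exists y.
  by rewrite within_dist.
(* Here [y] is not reached from [x], and [dist] takes its default value [#|T|], which is also its
   maximum. *)
exact: leq_trans (dist_le_card _ _) (leq_trans ge (leqnSn _)).
Qed.

Lemma dist_self x : dist e x x = 0%N.
Proof. by apply/eqP; rewrite -leqn0; apply: dist_le => /=. Qed.

Lemma dist_eq0 x y : (dist e x y == 0%N) = (x == y).
Proof.
apply/idP/eqP => [/eqP d0|->]; last by rewrite dist_self.
have : within e (dist e x y) x y by apply: within_dist; rewrite d0; apply/card_gt0P; exists x.
by rewrite d0 => /eqP.
Qed.

Lemma dist_adj x y : x != y -> e x y -> dist e x y = 1%N.
Proof.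
move=> xy exy; apply/eqP; rewrite eqn_leq lt0n dist_eq0 xy andbT -(dist_self x).
exact: dist_step.
Qed.

Lemma dist_common_nbr x y z : x != y -> ~~ e x y -> e x z -> e z y -> dist e x y = 2%N.
Proof.
move=> xy nxy xz zy.
have le2 : (dist e x y <= 2)%N.
  apply: leq_trans (dist_step x zy) _; rewrite ltnS.
  by apply: leq_trans (dist_step x xz) _; rewrite dist_self.
have ne1 : dist e x y != 1%N.
  apply: contra nxy => /eqP d1.
  have : within e (dist e x y) x y.
    apply: within_dist; rewrite d1; apply: leq_trans (_ : #|[set x; y]| <= _)%N.
      by rewrite cards2 xy.
    exact: max_card.
  by rewrite d1 /= (negPf xy) => /existsP[w /andP[/eqP<-]].
have ne0 : dist e x y != 0%N by rewrite dist_eq0.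
by case: (dist e x y) le2 ne1 ne0 => [|[|[|]]].
Qed.

(** Distances to [x] change by at most one along an edge, so [nbr_at] vanishes for all [j] other
    than the three of the definition. *)
Lemma nbr_at_eq x y x' y' j : distance_regular e -> dist e x y = dist e x' y' ->
  nbr_at e x y j = nbr_at e x' y' j.
Proof.
move=> [[sym_e _] [_ drg]] dd.
have [h0 h1 h2] := drg _ _ _ _ _ dd (erefl (dist e x' y')).
have far a b : dist e a b = dist e x' y' -> j != (dist e x' y').-1 ->
    j != dist e x' y' -> j != (dist e x' y').+1 -> nbr_at e a b j = 0%N.
  move=> dab; rewrite -dab => j0 j1 j2; apply: eq_card0 => w; rewrite !inE.
  apply/negP => /andP[bw /eqP dw]; have := dist_step a bw.
  have := @dist_step a w b; rewrite sym_e bw => /(_ isT); lia.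
case: (eqVneq j (dist e x' y').-1) => [->//|j0].
case: (eqVneq j (dist e x' y')) => [->//|j1].
case: (eqVneq j (dist e x' y').+1) => [->//|j2].
by rewrite !far.
Qed.
End Distance.

(** * The Bose-Mesner algebra and Delsarte's clique bound *)

Lemma eigen_annihilator (F : fieldType) n (A : 'M[F]_n) (s : F) : eigenvalue A s ->
  exists q : {poly F}, let E := \sum_(i < size q) q`_i *: A ^+ i in
    E != 0 /\ E *m A = s *: E.
Proof.
case: n A => [A /eigenvalueP[v _]|n A ev]; first by rewrite thinmx0 eqxx.
(* The witness is the minimal polynomial divided by ['X - s%:P]. Its degree is too small to
   annihilate [A], while its product with ['X - s%:P] does. *)
have /factor_theorem [q eq] : root (mxminpoly A) s by rewrite -eigenvalue_root_min.
have hE p : horner_mx A p = \sum_(i < size p) p`_i *: A ^+ i.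
  rewrite -{1}[p]coefK poly_def rmorph_sum; apply: eq_bigr => i _.
  by rewrite /= horner_mxZ rmorphXn /= horner_mx_X.
have minp_neq0 : mxminpoly A != 0 by rewrite monic_neq0 ?mxminpoly_monic.
have q_neq0 : q != 0 by apply: contraNneq minp_neq0 => q0; rewrite eq q0 mul0r.
exists q => /=; rewrite -hE; split.
  apply/negP => /eqP/mxminpoly_min/dvdp_leq => /(_ q_neq0).
  by rewrite eq size_Mmonic ?monicXsubC // size_XsubC addn2 ltnn.
apply/eqP; rewrite -subr_eq0 -mul_mx_scalar -mulmxBr.
have := mx_root_minpoly A; rewrite eq rmorphM /= rmorphB /= horner_mx_X horner_mx_C.
by move=> h; apply/eqP; exact: h.
Qed.

Section BoseMesner.
Variables (R : realType) (T : finType) (e : rel T).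
Hypothesis drg : distance_regular e.
Local Notation A := (adjmx e R).

(** Membership in the Bose-Mesner algebra, the span of the distance matrices. *)
Definition dist_mx (M : 'M[R]_#|T|) :=
  exists g : nat -> R, forall x y, M (enum_rank x) (enum_rank y) = g (dist e x y).

Lemma dist_mx_scalar a : dist_mx a%:M.
Proof.
exists (fun d => a *+ (d == 0%N)) => x y; rewrite mxE dist_eq0.
by rewrite (inj_eq enum_rank_inj).
Qed.

Lemma dist_mxD M M' : dist_mx M -> dist_mx M' -> dist_mx (M + M').
Proof. by move=> [g h] [g' h']; exists (fun d => g d + g' d) => x y; rewrite mxE h h'. Qed.

Lemma dist_mxZ a M : dist_mx M -> dist_mx (a *: M).
Proof. by move=> [g h]; exists (fun d => a * g d) => x y; rewrite mxE h. Qed.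

Lemma mulmx_adj (M : 'M[R]_#|T|) (x y : T) :
  (M *m A) (enum_rank x) (enum_rank y) = \sum_(w | e w y) M (enum_rank x) (enum_rank w).
Proof.
rewrite mxE [RHS]big_mkcond (reindex enum_rank) /=; last first.
  by apply: onW_bij; exact: enum_rank_bij.
apply: eq_bigr => w _; rewrite mxE !enum_rankK.
by case: (e w y); rewrite ?mulr1 ?mulr0.
Qed.

Lemma dist_mxMA M : dist_mx M -> dist_mx (M *m A).
Proof.
move=> [g h]; have [[sym_e _] _] := drg.
pose c x y := \sum_(j < #|T|.+1) g j *+ nbr_at e x y j.
have hc x y : (M *m A) (enum_rank x) (enum_rank y) = c x y.
  rewrite mulmx_adj /c.
  transitivity (\sum_(w | e y w) g (dist e x w)).
    by apply: eq_big => [w|w _]; rewrite ?h // sym_e.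
  rewrite (partition_big (fun w => inord (dist e x w) : 'I_#|T|.+1) predT) //=.
  apply: eq_bigr => j _; rewrite /nbr_at -sumr_const.
  have ino w : (inord (dist e x w) == j :> 'I_#|T|.+1) = (dist e x w == j).
    by rewrite -val_eqE /= inordK // ltnS dist_le_card.
  apply: eq_big => w; first by rewrite inE ino.
  by rewrite ino => /andP[_ /eqP->].
(* The entry is read off from an arbitrary pair at distance [d]; the value 0 at unrealised distances
   is irrelevant. *)
exists (fun d => if [pick p : T * T | dist e p.1 p.2 == d] is Some p then c p.1 p.2 else 0).
move=> x y; rewrite hc; case: pickP => [p /eqP dp|/(_ (x, y))]; last by rewrite eqxx.
by apply: eq_bigr => j _; congr (_ *+ _); apply: nbr_at_eq.
Qed.

Lemma dist_mx_horner (M : 'M_#|T|) (q : {poly R}) : dist_mx M ->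
  dist_mx (M *m \sum_(i < size q) q`_i *: A ^+ i).
Proof.
move=> hM; rewrite mulmx_sumr; elim/big_ind: _ => [||i _].
- by rewrite -(scale0r M); exact: dist_mxZ.
- exact: dist_mxD.
rewrite -scalemxAr; apply: dist_mxZ.
elim: (nat_of_ord i) => [|j IH]; first by rewrite expr0 mulmx1.
by rewrite exprSr mulmxA; exact: dist_mxMA.
Qed.

Lemma trmx_adj_horner (q : {poly R}) :
  (\sum_(i < size q) q`_i *: A ^+ i)^T = \sum_(i < size q) q`_i *: A ^+ i.
Proof.
have [[sym_e _] _] := drg.
have symA : A^T = A by apply/matrixP => i j; rewrite !mxE sym_e.
rewrite linear_sum; apply: eq_bigr => i _; rewrite linearZ /=; congr (_ *: _).
elim: (nat_of_ord i) => [|j IH]; first by rewrite expr0 trmx1.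
by rewrite exprS trmx_mul IH symA -exprS; apply/esym; exact: exprSr.
Qed.


(* With [E] a polynomial in [A] such that [E A = s E], the matrix [E E^T] is
   positive semidefinite, constant on the diagonal and on the edges; its ratio
   edge/diagonal is [s / k]. *)
Lemma delsarte_clique_bound k (s : R) (K : {set T}) : degree_is e k ->
  eigenvalue A s -> is_clique e K -> (0 < #|K|)%N ->
  0 <= k%:R + (#|K|%:R - 1) * s.
Proof.
move=> degk /eigen_annihilator [q []]; set E := (\sum_(i < _) _) => E0 EA cK K0.
have [[sym_e irr_e] _] := drg.
have symE : E^T = E by exact: trmx_adj_horner.
have [g hg] : dist_mx (E *m E).
  by apply: dist_mx_horner; rewrite -[E]mul1mx; apply/dist_mx_horner/dist_mx_scalar.
have FE x y : (E *m E) (enum_rank x) (enum_rank y) = \sum_l E (enum_rank x) l * E (enum_rank y) l.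
  by rewrite -{2}symE mxE; apply: eq_bigr => l _; rewrite mxE.
have g0 : 0 < g 0%N.
  have [i [l Eil]] : exists i l, E i l != 0 by exact/matrix0Pn.
  rewrite -(dist_self e (enum_val i)) -hg FE enum_valK.
  rewrite (bigD1 l) //= ltr_wpDr //; last by rewrite -expr2 exprn_even_gt0.
  by apply: sumr_ge0 => j _; rewrite -expr2 sqr_ge0.
(* Compare a diagonal entry on both sides of [E *m E *m A = s *: (E *m E)]: on the left it sums
   [g 1] over the [k] neighbours. *)
have g1 : k%:R * g 1%N = s * g 0%N.
  have [x _] : exists x, x \in K by apply/card_gt0P.
  have := mulmx_adj (E *m E) x x; rewrite -mulmxA EA -scalemxAr mxE hg dist_self => ->.
  rewrite -(degk x) mulr_natl -sumr_const; apply: eq_big => w.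
    by rewrite inE sym_e.
  rewrite inE => xw; rewrite hg dist_adj //.
  by apply: contraTneq xw => ->; rewrite irr_e.
(* This is the value of the form [E *m E^T] at the indicator vector of [K]. *)
have psd : 0 <= \sum_(x in K) \sum_(y in K) g (dist e x y).
  have -> : \sum_(x in K) \sum_(y in K) g (dist e x y) =
            \sum_l (\sum_(x in K) E (enum_rank x) l) ^+ 2.
    under eq_bigr do under eq_bigr do rewrite -hg FE.
    under eq_bigr do rewrite exchange_big /=.
    rewrite exchange_big; apply: eq_bigr => l _; rewrite expr2 mulr_suml.
    by apply: eq_bigr => x _; rewrite mulr_sumr.
  by apply: sumr_ge0 => l _; exact: sqr_ge0.
have sumE : \sum_(x in K) \sum_(y in K) g (dist e x y) =
    #|K|%:R * (g 0%N + (#|K|%:R - 1) * g 1%N).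
  rewrite mulr_natl -sumr_const; apply: eq_bigr => x xK.
  rewrite (big_setD1 x) //= dist_self; congr (_ + _).
  rewrite (cardsD1 x K) xK natrD addrC addKr mulr_natl -sumr_const.
  apply: eq_bigr => y; rewrite !inE => /andP[yx yK].
  by rewrite dist_adj // ?cK // eq_sym.
rewrite sumE pmulr_rge0 ?ltr0n // in psd.
rewrite -(pmulr_lge0 _ g0) mulrDl -mulrA -g1.
have -> : k%:R * g 0%N + (#|K|%:R - 1) * (k%:R * g 1%N) =
          k%:R * (g 0%N + (#|K|%:R - 1) * g 1%N) by ring.
by rewrite mulr_ge0.
Qed.

End BoseMesner.

(** * Bounds on the least eigenvalue and the degree *)

Section LeastEigenvalue.
Variables (R : realType) (T : finType) (e : rel T) (s : R).
Hypotheses (sym_e : symmetric e) (irr_e : irreflexive e).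
Hypothesis hs : least_eigenvalue e s.

Lemma adj_form_ge (f : T -> R) :
  s * (\sum_u f u * f u) <= \sum_u f u * \sum_(w | e u w) f w.
Proof.
have symA : (adjmx e R)^T = adjmx e R by apply/matrixP => i j; rewrite !mxE sym_e.
have sumE (h : T -> R) : \sum_u h u = \sum_(i < #|T|) h (enum_val i).
  by rewrite -big_enum_val.
have := @rayleigh_ge R _ _ s (\row_i f (enum_val i)) symA (proj2 hs).
rewrite -mulmxA !mxE !sumE.
under eq_bigr do rewrite !mxE.
under [X in _ <= X -> _]eq_bigr => i _.
  rewrite !mxE.
  under eq_bigr do rewrite !mxE.
  over.
congr (_ <= _); apply: eq_bigr => i _; congr (_ * _).
rewrite [RHS]big_mkcond sumE; apply: eq_bigr => j _.
by case: (e _ _); rewrite ?mul1r ?mul0r.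
Qed.

Variables (k lam : nat) (v : T).
Hypotheses (hk : degree_is e k) (hlam : lambda_is e lam).

(** Rayleigh bound for the vector equal to [a] at [v], [b] on the neighbours of [v], and 0
    elsewhere. *)
Lemma star_form_ge (a b : R) :
  s * (a ^+ 2 + k%:R * b ^+ 2) <= 2 * a * b * k%:R + b ^+ 2 * k%:R * lam%:R.
Proof.
pose f w := a *+ (w == v) + b *+ e v w.
have fv : f v = a by rewrite /f eqxx irr_e addr0.
have fN w : e v w -> f w = b.
  by move=> vw; rewrite /f vw; case: eqVneq vw => [->|]; rewrite ?irr_e ?add0r.
have sumf (h : T -> R) : \sum_u f u * h u = a * h v + b * \sum_(u | e v u) h u.
  under eq_bigr do rewrite mulrDl; rewrite big_split /=; congr (_ + _).
    rewrite (bigD1 v) //= eqxx big1 ?addr0 // => i /negPf->; exact: mul0r.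
  rewrite mulr_sumr [RHS]big_mkcond; apply: eq_bigr => i _.
  by case: (e v i); rewrite ?mul0r.
have card_sum (P : pred T) (c : R) : \sum_(u | P u) c = #|[set u | P u]|%:R * c.
  by rewrite mulr_natl -sumr_const; apply: eq_bigl => u; rewrite inE.
have sumN : \sum_(u | e v u) f u = k%:R * b.
  by rewrite (eq_bigr (fun=> b)) ?card_sum ?hk.
have sumNN u : e v u -> \sum_(w | e u w) f w = a + lam%:R * b.
  move=> vu; rewrite big_mkcond /=.
  rewrite (eq_bigr (fun w => f w * (e u w)%:R)); last first.
    by move=> w _; case: (e u w); rewrite ?mulr1 ?mulr0.
  rewrite sumf sym_e vu mulr1; congr (_ + _); rewrite [RHS]mulrC; congr (_ * _).
  rewrite -(hlam vu) -[RHS]mulr1 -card_sum [RHS]big_mkcondr.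
  by apply: eq_bigr => w _; case: (e u w).
have := adj_form_ge f; rewrite !sumf fv sumN.
rewrite (eq_bigr (fun=> a + lam%:R * b)) // card_sum hk.
congr (_ <= _); ring.
Qed.

Lemma least_eigenvalue_le0 : s <= 0.
Proof. by have := star_form_ge 1 0; lra. Qed.

Lemma least_eigenvalue_lt0 u : e v u -> s < 0.
Proof.
move=> vu; rewrite lt_neqAle least_eigenvalue_le0 andbT; apply/eqP => s0.
have : 0 < k%:R :> R by rewrite ltr0n -(hk v); apply/card_gt0P; exists u; rewrite inE.
(* For [s = 0] these values make the right-hand side [- k * (lam + 2)], which is negative. *)
have := star_form_ge (lam%:R + 1) (-1); rewrite s0.
have : 0 <= lam%:R :> R by [].
by nra.
Qed.

Hypothesis lam_gt0 : (0 < lam)%N.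

Lemma degree_le : k%:R <= - s * (lam%:R - s).
Proof.
have s0 := least_eigenvalue_le0.
have l0 : 0 < lam%:R - s by rewrite subr_gt0 (le_lt_trans s0) // ltr0n.
(* The ratio [b = - a / (lam - s)] minimises the form of [A - s I] in [b] for fixed [a]. *)
have := star_form_ge (lam%:R - s) (-1) => h.
have : 0 <= (lam%:R - s) * (- s * (lam%:R - s) - k%:R) by nra.
by rewrite pmulr_rge0 // subr_ge0.
Qed.

Lemma least_eigenvalue_le_m1 u : e v u -> s <= -1.
Proof.
move=> vu; have hd := degree_le; have s0 := least_eigenvalue_le0.
have lt_lk : (lam < k)%N.
  rewrite -(hlam vu) -(hk v); apply: proper_card; apply/properP; split.
    by apply/subsetP => w; rewrite !inE => /andP[].
  by exists u; rewrite inE ?vu // irr_e andbF.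
have : lam%:R + 1 <= k%:R :> R by rewrite natr1 ler_nat.
have l0 : 0 < lam%:R :> R by rewrite ltr0n.
(* Substitute [lam <= k - 1] into [degree_le] and factor. *)
move=> lk; have : 0 <= (k%:R - s) * (- s - 1) by nra.
rewrite pmulr_rge0; lra.
Qed.
End LeastEigenvalue.

(** * Geometries of a single distance-regular graph *)

(** The inequality of [stable_degree_ge] is quadratic in the order and may hold again for large
    stable sets, so a larger set is first cut down to order exactly [t]. *)
Lemma stable_card_le (T : finType) (e : rel T) k lam mu t :
  symmetric e -> degree_is e k -> lambda_is e lam ->
  (forall x y, x != y -> ~~ e x y -> (#|[set w | e x w & e y w]| <= mu)%N) ->
  (k + t * t * mu < t * lam)%N ->
  forall v (S : {set T}), S \subset [set w | e v w] -> stable_pred e S -> (#|S| <= t)%N.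
Proof.
move=> sym_e hk hlam hmu big v S SN stS; rewrite leqNgt; apply/negP => lt.
pose S' := [set x in take t (enum S)].
have cS' : #|S'| = t.
  rewrite cardsE (card_uniqP (take_uniq _ (enum_uniq _))) size_takel //.
  by rewrite -cardE ltnW.
have sS' : S' \subset S.
  by apply/subsetP => x; rewrite inE => /mem_take; rewrite mem_enum.
have stS' : stable_pred e S'.
  by apply/stable_predP => x y xS yS; apply: (stable_predP _ _ stS); exact: (subsetP sS').
have := stable_degree_ge hlam hmu (subset_trans sS' SN) stS' (hk v).
by rewrite cS' leqNgt big.
Qed.

Section DistanceRegular.
Variables (R : realType) (T : finType) (e : rel T) (k lam mu : nat) (s eps : R).
Hypotheses (drg : distance_regular e) (hk : degree_is e k) (hlam : lambda_is e lam)
  (hmu : mu_is e mu) (hs : least_eigenvalue e s).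

Let sym_e : symmetric e. Proof. by case: drg => -[]. Qed.
Let irr_e : irreflexive e. Proof. by case: drg => -[]. Qed.

Lemma common_nbrs_le x y : x != y -> ~~ e x y -> (#|[set w | e x w & e y w]| <= mu)%N.
Proof.
move=> xy nxy; have [->|[z]] := set_0Vmem [set w | e x w & e y w]; first by rewrite cards0.
rewrite inE sym_e (sym_e y) => /andP[zx zy].
by rewrite hmu // (dist_common_nbr xy nxy _ zy) // sym_e.
Qed.

(** The vertices [x], [y], [z] witness a pair at distance two. Hence [mu >= 1], and [sg] itself is
    at most [sg * mu], small against [lam]. *)
Lemma delsarte_geometry x y z : x != y -> ~~ e x y -> e x z -> e z y ->
  20 * (`|s| * mu%:R) <= lam%:R -> 8 * (`|s| * mu%:R / lam%:R) <= eps ->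
  exists C : {set {set T}}, clique_geometry e C /\
    forall K, K \in C -> (1 - eps) * k%:R / `|s| <= #|K|%:R /\
                        #|K|%:R <= (1 + eps) * k%:R / `|s|.
Proof.
move=> xy nxy xz zy small_smu le_eps.
have mu1 : 1 <= mu%:R :> R.
  rewrite -(hmu (dist_common_nbr xy nxy xz zy)) ler1n; apply/card_gt0P; exists z.
  by rewrite inE xz sym_e.
have s0 : s < 0 by exact: (least_eigenvalue_lt0 sym_e irr_e hs hk hlam xz).
move: small_smu le_eps; rewrite ltr0_norm // => small_smu le_eps.
have lam_gt0 : (0 < lam)%N by rewrite -(ltr0n R); nra.
have s1 : s <= -1 by exact: (least_eigenvalue_le_m1 sym_e irr_e hs hk hlam lam_gt0 xz).
have degk := degree_le sym_e irr_e hs x hk hlam lam_gt0.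
move: (@delsarte_clique_bound R T e drg k s) => delsarte.
pose sg := - s; have sE : s = - sg by rewrite /sg opprK.
rewrite {1}sE in s1; rewrite -/sg in small_smu le_eps degk *.
have {s1} sg1 : 1 <= sg by lra.
have l0 : 0 < lam%:R :> R by rewrite ltr0n.
have sgmu : sg <= sg * mu%:R by nra.
have [] := andP (Num.Theory.truncn_itv (_ : 0 <= 2 * sg)); first by lra.
(* Thus [2 * sg < t <= 3 * sg], the upper bound using [sg >= 1]. *)
set t := (Num.truncn (2 * sg)).+1 => t_le t_gt.
have t_le3 : t%:R <= 3 * sg by rewrite /t -natr1; lra.
have tmu : t%:R * mu%:R <= 3 * (sg * mu%:R) by nra.
(* Here [k <= 21/20 * sg * lam] and [t * t * mu <= 3/20 * t * lam], while
   [t * lam >= 2 * sg * lam]. *)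
have big : (k + t * t * mu < t * lam)%N.
  rewrite -(ltr_nat R) natrD !natrM.
  have : t%:R * (t%:R * mu%:R) <= t%:R * (3 / 20 * lam%:R) :> R by apply: ler_wpM2l => //; lra.
  have : sg * sg <= sg * (lam%:R / 20) by apply: ler_wpM2l; lra.
  have : 2 * (sg * lam%:R) <= t%:R * lam%:R by nra.
  have : 0 < sg * lam%:R by nra.
  nra.
have small : ((2 * t + 1) * mu + 2 < lam)%N.
  by rewrite -(ltr_nat R) natrD natrM natrD natrM; nra.
have ht := stable_card_le sym_e hk hlam common_nbrs_le big.
exists (lines e lam mu t); split.
  exact: (lines_clique_geometry sym_e irr_e hlam common_nbrs_le ht small).
move=> K; rewrite inE => /andP[/maximal_cliqueP[cK _]].
rewrite -(ler_nat R) natrD natrM => Kge.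
have K_gt0 : (0 < #|K|)%N by rewrite -(ltr0n R); lra.
have := delsarte K hk (proj1 hs) cK K_gt0; rewrite sE => dK.
pose r := k%:R / sg; have kE : k%:R = r * sg by rewrite /r divfK //; lra.
have sg0 : 0 < sg by lra.
have y_ge : #|K|%:R - 1 <= r by rewrite /r ler_pdivlMr //; lra.
have y_le : r <= lam%:R + sg by rewrite /r ler_pdivrMr //; lra.
rewrite -!mulrA -/r.
have y_half : lam%:R / 2 <= r by lra.
(* The order of [K] is within [4 * sg * mu] of [r]: at most [r + 1], and at least
   [lam - t * mu >= r - sg - 3 * sg * mu]. *)
have eps_y : 4 * (sg * mu%:R) <= eps * r.
  apply: le_trans (_ : 8 * (sg * mu%:R / lam%:R) * (lam%:R / 2) <= _).
    rewrite le_eqVlt; apply/orP; left; apply/eqP; field; lra.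
  apply: le_trans (ler_wpM2r _ le_eps) _; first by lra.
  apply: ler_wpM2l => //; apply: le_trans le_eps.
  by rewrite mulr_ge0 // divr_ge0 //; lra.
split; lra.
Qed.

Lemma connected_complete : (forall x y z, x != y -> e x z -> e z y -> e x y) ->
  forall x y, x != y -> e x y.
Proof.
move=> tr x y; have [_ [conn _]] := drg.
have /connectP[p] := conn x y; elim/last_ind: p y => [|p z IH] y /=.
  by move=> _ ->; rewrite eqxx.
rewrite rcons_path last_rcons => /andP[pth ez] -> xz.
case: (eqVneq x (last x p)) => [xl|xl]; first by rewrite {1}xl.
apply: (tr _ _ (last x p)) => //.
exact: IH.
Qed.

Lemma complete_geometry : (2 < #|T|)%N -> (forall x y, x != y -> e x y) ->
  2 / #|T|%:R <= eps ->
  exists C : {set {set T}}, clique_geometry e C /\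
    forall K, K \in C -> (1 - eps) * k%:R / `|s| <= #|K|%:R /\
                        #|K|%:R <= (1 + eps) * k%:R / `|s|.
Proof.
move=> n2 full le_eps.
have cT : is_clique e [set: T] by move=> x y _ _; exact: full.
have [x _] : exists x, x \in [set: T] by apply/card_gt0P; rewrite cardsT; lia.
have kE : k = #|T|.-1.
  rewrite -(hk x) -(cardsC1 x); apply: eq_card => w; rewrite !inE.
  apply/idP/idP => [|wx]; last by rewrite full // eq_sym.
  by apply: contraTneq => ->; rewrite irr_e.
have [y xy] : exists y, e x y.
  have : (0 < #|[set w | e x w]|)%N by rewrite hk kE; lia.
  by case/card_gt0P => y; rewrite inE; exists y.
have lam_gt0 : (0 < lam)%N.
  have : (0 < #|[set~ x] :\ y|)%N.
    have := cardsD1 y [set~ x]; rewrite cardsC1 !inE.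
    case: (y != x); lia.
  case/card_gt0P => z; rewrite !inE => /andP[zy zx].
  rewrite -(hlam xy); apply/card_gt0P; exists z; rewrite inE !full // eq_sym //.
have s1 : s <= -1 by exact: (least_eigenvalue_le_m1 sym_e irr_e hs hk hlam lam_gt0 xy).
have nE : #|T|%:R = k%:R + 1 :> R by rewrite kE natr1 prednK //; lia.
have k1 : 1 <= k%:R :> R by rewrite ler1n kE; lia.
have := @delsarte_clique_bound R T e drg k s [set: T] hk (proj1 hs) cT.
rewrite cardsT => /(_ (ltnW (ltnW n2))); rewrite nE => dT.
(* Delsarte's bound for the whole vertex set reads [0 <= k + k * s]. *)
have {dT} sE : s = -1 by apply/eqP; rewrite eq_le s1 /=; nra.
rewrite sE normrN1 !divr1.
exists [set [set: T]]; split; last first.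
  move=> K /set1P->; rewrite cardsT nE.
  (* The only special clique has order [k + 1] against [k / |s| = k], so [eps * k >= 1] is needed;
     it follows as [2 * k >= k + 1]. *)
  have : 2 <= eps * (k%:R + 1) by rewrite -ler_pdivrMr // -?nE //; lra.
  split; nra.
split=> [K /set1P->|a b ab].
  by split=> // K' _; rewrite subTset => /eqP.
by exists [set: T]; split=> [|K [/set1P->]]; rewrite !inE.
Qed.
End DistanceRegular.

(** * Passage to the sequence of graphs *)

Theorem theorem9 (R : realType) (T : nat -> finType) (e : forall i, rel (T i))
  (k lam mu : nat -> nat) (s : nat -> R)
  (hdrg : forall i, distance_regular (e i))
  (hk : forall i, degree_is (e i) (k i))
  (hlam : forall i, lambda_is (e i) (lam i))
  (hmu : forall i, mu_is (e i) (mu i))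
  (hs : forall i, least_eigenvalue (e i) (s i))
  (hn : forall M : nat, exists N : nat, forall i, (N <= i)%N -> (M <= #|T i|)%N)
  (hsmu : forall d : R, 0 < d -> exists N : nat, forall i, (N <= i)%N ->
            `|s i| * (mu i)%:R <= d * (lam i)%:R) :
  exists eps : nat -> R,
    (forall d : R, 0 < d -> exists N : nat, forall i, (N <= i)%N -> `|eps i| <= d) /\
    exists N : nat, forall i, (N <= i)%N ->
      exists C : {set {set T i}}, clique_geometry (e i) C /\
        forall K, K \in C ->
          (1 - eps i) * (k i)%:R / `|s i| <= #|K|%:R /\
          #|K|%:R <= (1 + eps i) * (k i)%:R / `|s i|.
Proof.
(* The first summand is the error for graphs with a pair at distance two, the second that for
   complete graphs. *)
pose eps i : R := 8 * (`|s i| * (mu i)%:R / (lam i)%:R) + 2 / #|T i|%:R.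
exists eps; split=> [d d0|].
  have [|N1 hN1] := hsmu (d / 16); first by lra.
  have [N2 hN2] := hn (Num.truncn (4 / d)).+1.
  exists (maxn N1 N2) => i; rewrite geq_max => /andP[/hN1 le1 /hN2 le2].
  have n_gt0 : 0 < #|T i|%:R :> R by rewrite ltr0n (leq_trans _ le2).
  have ratio_ge0 : 0 <= `|s i| * (mu i)%:R / (lam i)%:R by rewrite divr_ge0 ?mulr_ge0.
  have inv_ge0 : 0 <= 2 / #|T i|%:R :> R by rewrite divr_ge0.
  have ratio_le : `|s i| * (mu i)%:R / (lam i)%:R <= d / 16.
    (* If [lam i = 0], the quotient is 0 by the convention for division by zero. *)
    case: (posnP (lam i)) => [->|l0]; first by rewrite invr0 mulr0; lra.
    by rewrite ler_pdivrMr ?ltr0n.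
  have inv_le : 2 / #|T i|%:R <= d / 2.
    rewrite ler_pdivrMr //; have d4 : 0 <= 4 / d by rewrite divr_ge0 // ltW.
    have /andP[_ lt4] := truncn_itv d4.
    have : 4 / d <= #|T i|%:R by rewrite (le_trans (ltW lt4)) // ler_nat.
    by rewrite ler_pdivrMr //; lra.
  by rewrite ger0_norm /eps; lra.
have [|N1 hN1] := hsmu (1 / 20); first by lra.
have [N2 hN2] := hn 3.
exists (maxn N1 N2) => i; rewrite geq_max => /andP[/hN1 le1 /hN2 le2].
have ratio_ge0 : 0 <= `|s i| * (mu i)%:R / (lam i)%:R by rewrite divr_ge0 ?mulr_ge0.
have inv_ge0 : 0 <= 2 / #|T i|%:R :> R by rewrite divr_ge0.
have [/existsP[[[x y] z] /and4P[/= xy nxy xz zy]]|] :=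
  boolP [exists p : T i * T i * T i, [&& p.1.1 != p.1.2, ~~ e i p.1.1 p.1.2,
                                         e i p.1.1 p.2 & e i p.2 p.1.2]].
  by apply: (delsarte_geometry (hdrg i) (hk i) (hlam i) (hmu i) (hs i) xy nxy xz zy);
    rewrite /eps; lra.
rewrite negb_exists => /forallP none.
apply: (complete_geometry (hdrg i) (hk i) (hlam i) (hs i)) => //; last by rewrite /eps; lra.
apply: (connected_complete (hdrg i)) => x y z xy xz zy; apply: contraT => nxy.
by have := none (x, y, z); rewrite /= xy nxy xz zy.
Qed.
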